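(* Let $d\ge1$, $n\ge d+1$ and $T=\{t_1<\dots<t_n\}\subset\mathbb R$. Consider the central hyperplane arrangement in $\mathbb R^{d+1}$ consisting of the hyperplanes $H_t=\{\xi:q_\xi(t)=0\}$, $t\in T$. For a chamber $\sigma$ of this arrangement, assign to $\sigma$ the signed decomposition of $T$ obtained by cutting $T$ into maximal runs of consecutive elements on which $\mathrm{sgn}\,q_\xi$ is constant (for any $\xi$ in the interior of $\sigma$), each run carrying that sign. This assignment is well defined and is a bijection between the chambers of the arrangement and the signed decompositions of $T$ of length at most $d$. Moreover, it induces a bijection between the pairs $\{\sigma,-\sigma\}$ of opposite chambers and the (unsigned) decompositions of $T$ into at most $d+1$ discrete intervals.
   Context: $q_\xi(t)=\sum_{i=0}^d\xi_it^i$ for $\xi=(\xi_0,\dots,\xi_d)$. Chambers are the closures of the connected components of the complement of the arrangement (closed full-dimensional pointed polyhedral cones). A signed decomposition of length at most $d$ of $T$ is a partition of $T$ into discrete intervals (sets of consecutive elements) $I_1<I_2<\dots<I_{k+1}$, $0\le k\le d$, each equipped with a sign $\mathrm{sgn}(I_i)\in\{\pm1\}$, such that $\mathrm{sgn}(I_i)=-\mathrm{sgn}(I_{i+1})$ for $i\in[k]$. *)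

(* Defs.v *)
From mathcomp Require Import all_boot all_order all_algebra.
From mathcomp Require Import finmap.
From mathcomp Require Import all_classical all_reals all_analysis.
Import Order.TTheory GRing.Theory Num.Theory.
Import numFieldNormedType.Exports.
Set Implicit Arguments.
Unset Strict Implicit.
Unset Printing Implicit Defensive.

Local Open Scope classical_set_scope.
Local Open Scope ring_scope.

Section Arrangement.
Variables (R : realType) (d : nat).
Implicit Types (xi : 'rV[R]_d.+1) (T : {fset R}) (sigma : set 'rV[R]_d.+1).

Definition q_fun xi (t : R) : R := \sum_(i < d.+1) xi 0 i * t ^+ i.

Definition hyperplane (t : R) : set 'rV[R]_d.+1 := [set xi | q_fun xi t = 0].

Definition arrangement_compl T : set 'rV[R]_d.+1 :=
  ~` \bigcup_(t in [set` T]) hyperplane t.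

Definition chambers T : set (set 'rV[R]_d.+1) :=
  [set sigma | exists2 xi, arrangement_compl T xi &
     sigma = closure (connected_component (arrangement_compl T) xi)].

Definition opposite sigma : set 'rV[R]_d.+1 := [set - xi | xi in sigma].

Definition opposite_pairs T : set (set (set 'rV[R]_d.+1)) :=
  [set [set sigma; opposite sigma] | sigma in chambers T].

End Arrangement.

(* Subsets of the finite set [T] of reals are elements of [{set T}], where [T]
   is viewed as a finite type; [val] recovers the underlying real numbers. *)
Section Decompositions.
Variables (R : realType) (T : {fset R}).
Implicit Types (I J : {set T}) (D : seq {set T}) (S : seq ({set T} * int)).

Definition discrete_interval I : bool :=
  (I != finset.set0) &&
  [forall x in I, forall z in I, forall y : T,
     (val x <= val y <= val z) ==> (y \in I)].

Definition before I J : bool :=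
  [forall x in I, forall y in J, val x < val y].

(* A partition of [T] into intervals I_1 < ... < I_(k+1) with k <= d, given as
   the sequence of its parts. *)
Definition decomposition (d : nat) D : bool :=
  [&& (0 < size D <= d.+1)%N, all discrete_interval D, sorted before D
    & finset.partition [set:: D]%SET [set: T]%SET].

Definition signed_decomposition (d : nat) S : bool :=
  [&& decomposition d (unzip1 S),
      all (fun s : int => (s == 1) || (s == -1)) (unzip2 S)
    & sorted (fun s s' : int => s == - s') (unzip2 S)].

Definition sign_run (f : R -> R) I : bool :=
  discrete_interval I &&
  [forall x in I, forall y in I, sgz (f (val x)) == sgz (f (val y))].

(* [S] lists, in increasing order, the inclusion-maximal sign runs of [f] on
   [T], each paired with the sign of [f] on it. *)
Definition cut_into_runs (f : R -> R) S : Prop :=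
  [/\ sorted before (unzip1 S),
      forall I, (I \in unzip1 S) = maxset (sign_run f) I
    & forall I s, (I, s) \in S -> forall x : T, x \in I -> sgz (f (val x)) = s].

End Decompositions.

(* Main.v *)
(* The points of the complement with a given sign vector on [T] form a convex
   set, and the sign vector is constant on connected subsets, so these cells are
   the connected components; the interior of a closed cell is the cell itself.
   Chambers thus correspond to the sign vectors on [T] of polynomials of degree
   at most [d] that do not vanish on [T], i.e. to the block decompositions of
   [T] with alternating signs that such polynomials realise. A sign change
   between consecutive blocks forces a root, so at most [d + 1] blocks occur;
   conversely [k + 1] blocks are realised by [+-] a product of [k] factors
   [X - c], one [c] between each two consecutive blocks. Finally, alternating
   signs are determined by the blocks up to a global sign, and the global sign
   change is [xi |-> - xi]. *)
Require Import Defs.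
From mathcomp Require Import all_boot all_order all_algebra.
From mathcomp Require Import finmap.
From mathcomp Require Import all_classical all_reals all_analysis.
Import Order.TTheory GRing.Theory Num.Theory.
Import numFieldNormedType.Exports.
Local Open Scope classical_set_scope.
Local Open Scope ring_scope.

Local Notation alternation := (sorted (fun s s' : int => s == - s')).

(** * Ordered blocks of [T] and the maximal runs of a sign function *)

Section Blocks.
Context {R : realType} {T : {fset R}}.
Implicit Types (I J : {set T}) (D : seq {set T}) (S : seq ({set T} * int)).

Local Notation nonempty := (fun I : {set T} => I != finset.set0).

Lemma beforeP I J :
  reflect (forall x y, x \in I -> y \in J -> val x < val y) (before I J).
Proof.
apply: (iffP forall_inP) => [IJ x y xI yJ|IJ x xI].
  exact: (forall_inP (IJ x xI)).
by apply/forall_inP => y; apply: IJ.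
Qed.

(** [before] holds vacuously when one side is empty, so transitivity needs a point in the middle
    block. *)
Lemma before_trans :
  {in [pred I : {set T} | I != finset.set0] & &, transitive (@before R T)}.
Proof.
move=> J I K /set0Pn[y yJ] _ _ /beforeP IJ /beforeP JK.
by apply/beforeP => x z xI zK; apply: lt_trans (IJ _ _ xI yJ) (JK _ _ yJ zK).
Qed.

Lemma before_irr : {in [pred I : {set T} | I != finset.set0], irreflexive (@before R T)}.
Proof.
move=> I /set0Pn[x xI]; apply/negP => /beforeP/(_ _ _ xI xI).
by rewrite ltxx.
Qed.

Lemma blocks_nth_lt D (i j : nat) : all nonempty D -> sorted (@before R T) D ->
  (i < j < size D)%N -> forall x y, x \in nth finset.set0 D i ->
  y \in nth finset.set0 D j -> val x < val y.
Proof.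
move=> D0; rewrite (sorted_pairwise_in before_trans D0).
move=> /(pairwiseP finset.set0) DP /andP[ij jD]; apply/beforeP.
by apply: DP => //; rewrite inE ?(ltn_trans ij).
Qed.

(** On nonempty blocks [before] is a strict order, so a sorted list is determined by its members. *)
Lemma blocks_eq D1 D2 : all nonempty D1 -> sorted (@before R T) D1 ->
  sorted (@before R T) D2 -> D1 =i D2 -> D1 = D2.
Proof.
move=> /allP D1n; apply: irr_sorted_eq_in.
  by move=> I J K /D1n I0 /D1n J0 /D1n K0; apply: before_trans.
by move=> I /D1n; apply: before_irr.
Qed.

(** A point between two points of [I] lies in some block, and a block at another position lies
    entirely to one side of [I]. *)
Lemma blocks_intervals D I : all nonempty D -> sorted (@before R T) D ->
  (forall x, exists2 J, J \in D & x \in J) -> I \in D -> discrete_interval I.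
Proof.
move=> D0 Ds Dc ID; apply/andP; split; first exact: (allP D0).
apply/forall_inP => x xI; apply/forall_inP => z zI; apply/forallP => y.
apply/implyP => /andP[xy yz].
have [J JD yJ] := Dc y.
case: (ltngtP (index I D) (index J D)) => [ij|ji|ij].
- have zy : val z < val y.
    by apply: (blocks_nth_lt D (index I D) (index J D) D0 Ds); rewrite ?ij ?index_mem ?nth_index.
  by have := lt_le_trans zy yz; rewrite ltxx.
- have yx : val y < val x.
    by apply: (blocks_nth_lt D (index J D) (index I D) D0 Ds); rewrite ?ji ?index_mem ?nth_index.
  by have := lt_le_trans yx xy; rewrite ltxx.
- by rewrite -(nth_index finset.set0 ID) ij nth_index.
Qed.

(** For nonempty blocks, order and covering already force the parts to be disjoint intervals. *)
Lemma decompositionP d D :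
  reflect [/\ (0 < size D <= d.+1)%N, all nonempty D, sorted (@before R T) D
            & forall x, exists2 I, I \in D & x \in I]
          (decomposition d D).
Proof.
apply: (iffP and4P) => [[Dd DI Ds /and3P[/eqP DT _ _]]|[Dd D0 Ds Dc]]; split => //.
- by apply: sub_all DI => I /andP[].
- move=> x; have : x \in finset.cover [set:: D]%SET by rewrite DT inE.
  by case/finset.bigcupP => I; rewrite inE; exists I.
- by apply/allP => I; apply: blocks_intervals.
- apply/and3P; split.
  + rewrite finset.eqEsubset finset.subsetT; apply/fintype.subsetP => x _; have [I ID xI] := Dc x.
    by apply/finset.bigcupP; exists I; rewrite ?inE.
  + apply/finset.trivIsetP => I J; rewrite !inE => ID JD.
    rewrite -(nth_index finset.set0 ID) -(nth_index finset.set0 JD).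
    set i := index I D; set j := index J D => IJ.
    have iD : (i < size D)%N by rewrite index_mem.
    have jD : (j < size D)%N by rewrite index_mem.
    apply/pred0P => x; apply/negP => /andP[/= xi xj].
    case: (ltngtP i j) => [ij|ji|ij]; last by rewrite ij eqxx in IJ.
      have := blocks_nth_lt D i j D0 Ds _ x x xi xj.
      by rewrite ltxx ij jD => /(_ isT).
    have := blocks_nth_lt D j i D0 Ds _ x x xj xi.
    by rewrite ltxx ji iD => /(_ isT).
  + by apply/negP; rewrite inE => /(allP D0); rewrite eqxx.
Qed.

(** A local form of the cut of [T] by the signs [g]: alternation of neighbouring signs stands in for
    maximality of the runs. *)
Definition sign_blocks S (g : T -> int) : Prop :=
  [/\ all nonempty (unzip1 S), sorted (@before R T) (unzip1 S),
      alternation (unzip2 S),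
      forall x, exists2 p, p \in S & x \in p.1
    & forall I s, (I, s) \in S -> forall x, x \in I -> g x = s].

(** [T] is scanned from right to left: a new point joins the leftmost block when the signs agree and
    opens a new block otherwise. *)
Lemma sign_blocks_exist (g : T -> int) : (forall x, (g x == 1) || (g x == -1)) ->
  exists S, sign_blocks S g.
Proof.
move=> g1.
(* Keeping the blocks inside [l] ensures that a new smallest point precedes all of them. *)
suff H (l : seq T) : sorted (fun x y => val x < val y) l -> exists S,
  [/\ all nonempty (unzip1 S), sorted (@before R T) (unzip1 S),
      alternation (unzip2 S),
      {in l, forall x, exists2 p, p \in S & x \in p.1}
    & forall I s, (I, s) \in S -> {in I, forall x, x \in l /\ g x = s}].
  pose l := sort (fun x y : T => val x <= val y) (enum (@predT T)).
  have ls : sorted (fun x y => val x < val y) l.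
    change (sorted (relpre val <%R) l).
    rewrite -sorted_map lt_sorted_uniq_le map_inj_uniq; last exact: val_inj.
    rewrite sort_uniq enum_uniq /= sorted_map.
    by apply: sort_sorted => x y; apply: le_total.
  have [S [S0 Ss Sa Sc Sg]] := H l ls; exists S; split=> //.
    by move=> x; apply: Sc; rewrite mem_sort mem_enum.
  by move=> I s IS x xI; have [] := Sg I s IS x xI.
elim: l => [_|x l IH]; first by exists [::].
move=> /= xl; have [S [S0 Ss Sa Sc Sg]] := IH (path_sorted xl).
have xlt y : y \in l -> val x < val y.
  have tr : transitive (fun x y : T => val x < val y).
    by move=> ? ? ?; apply: lt_trans.
  by move=> yl; have /allP/(_ _ yl) := order_path_min tr xl.
case: S S0 Ss Sa Sc Sg => [|[I s] S] S0 Ss Sa Sc Sg.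
  exists [:: ([set x]%SET, g x)]; split => //=.
  - by rewrite andbT; apply/set0Pn; exists x; rewrite inE.
  - move=> y; rewrite inE => /orP[/eqP->|/Sc[]//].
    by exists ([set x]%SET, g x); rewrite ?mem_seq1 ?inE.
  - move=> I s; rewrite inE => /eqP[-> ->] y; rewrite inE => /eqP->.
    by rewrite mem_head.
have /andP[I0 S0'] : (I != finset.set0) && all nonempty (unzip1 S) := S0.
have [gs|gs] := eqVneq (g x) s.
  exists ((x |: I, s)%SET :: S); split => //=.
  - by apply/andP; split=> //; apply/set0Pn; exists x; rewrite !inE eqxx.
  - case: S Ss {S0 Sa Sc S0'} Sg => //= -[J t] S /= /andP[/beforeP IJ ->] Sg.
    rewrite andbT; apply/beforeP => y z; rewrite !inE => /orP[/eqP->|yI] zJ.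
      by apply: xlt; case: (Sg J t _ z zJ); rewrite // !inE eqxx orbT.
    exact: IJ.
  - move=> y; rewrite inE => /orP[/eqP->|/Sc[p]].
      by exists (x |: I, s)%SET; rewrite ?inE eqxx.
    rewrite inE => /orP[/eqP-> /= yI|pS yp].
      by exists (x |: I, s)%SET; rewrite !inE ?eqxx ?yI ?orbT.
    by exists p; rewrite // inE pS orbT.
  - move=> J t; rewrite inE => /orP[/eqP[-> ->]|JS] y.
      rewrite !inE => /orP[/eqP->|yI]; first by rewrite eqxx.
      by have [->] := Sg I s (mem_head _ _) y yI; rewrite orbT.
    move=> yJ; have [] := Sg J t _ y yJ; first by rewrite inE JS orbT.
    by move=> yl ->; rewrite inE yl orbT.
exists (([set x]%SET, g x) :: (I, s) :: S); split => //.
- by apply/andP; split=> //; apply/set0Pn; exists x; rewrite inE.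
- rewrite /= in Ss *; rewrite Ss andbT; apply/beforeP => y z; rewrite inE => /eqP-> zI.
  by apply: xlt; have [] := Sg I s (mem_head _ _) z zI.
- rewrite /= in Sa *; rewrite Sa andbT.
  (* Among the values 1 and -1, unequal means opposite; this gives alternation at the new block. *)
  have /set0Pn[z zI] := I0; have [_ gz] := Sg I s (mem_head _ _) z zI.
  move: gs; rewrite -gz; have := g1 z; have := g1 x.
  by move=> /orP[]/eqP-> /orP[]/eqP->.
- move=> y; rewrite inE => /orP[/eqP->|/Sc[p pS yp]].
    by exists ([set x]%SET, g x); rewrite ?mem_head ?inE.
  by exists p; rewrite // inE pS orbT.
- move=> J t; rewrite inE => /orP[/eqP[-> ->] y|JS y yJ].
    by rewrite inE => /eqP->; rewrite mem_head.
  by have [yl ->] := Sg J t JS y yJ; rewrite inE yl orbT.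
Qed.

Lemma sign_blocks_nth S g (i : nat) : sign_blocks S g -> (i < size S)%N ->
  exists2 x, x \in nth finset.set0 (unzip1 S) i & g x = nth 0 (unzip2 S) i.
Proof.
move=> [S0 _ _ _ Sg] iS.
have /set0Pn[x xi] : nth finset.set0 (unzip1 S) i != finset.set0.
  by apply: (allP S0); rewrite mem_nth // size_map.
exists x => //; apply: Sg xi.
rewrite !(nth_map (finset.set0, 0)) // -surjective_pairing.
exact: mem_nth.
Qed.

Lemma alternation_neq (s : seq int) (i : nat) : all (fun a => a != 0) s ->
  alternation s -> (i.+1 < size s)%N -> nth 0 s i != nth 0 s i.+1.
Proof.
move=> s0 sa iS; have /(sortedP 0)/(_ i iS)/eqP-> := sa.
have := allP s0 _ (mem_nth 0 iS); set a := nth _ _ _ => a0.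
by rewrite eq_sym -addr_eq0 -mulr2n mulrn_eq0.
Qed.

(** Alternation yields maximality: a run meeting two blocks would also contain a point of the block
    right after the earlier one, where the sign differs. So a run that meets a block is contained in
    it. *)
Lemma sign_blocks_cut S (f : R -> R) : (forall x : T, f (val x) != 0) ->
  sign_blocks S (fun x => sgz (f (val x))) -> cut_into_runs f S.
Proof.
set g := fun x : T => sgz (f (val x)).
move=> f0 SS; have [S0 Ss Sa Sc Sg] := SS.
have S2 : all (fun a => a != 0) (unzip2 S).
  apply/(all_nthP 0) => i; rewrite size_map => iS.
  have [x _ <-] := sign_blocks_nth _ _ _ SS iS.
  by rewrite /g sgz_eq0.
have Sc1 x : exists2 I, I \in unzip1 S & x \in I.
  by have [p pS xp] := Sc x; exists p.1 => //; apply/mapP; exists p.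
have run I : I \in unzip1 S -> sign_run f I.
  move=> /mapP[[J s] JS ->] /=; apply/andP; split.
    by apply: (blocks_intervals (unzip1 S)) => //; apply: (map_f fst JS).
  apply/forall_inP => x xJ; apply/forall_inP => y yJ.
  by rewrite [sgz _](Sg _ _ JS x xJ) [sgz _](Sg _ _ JS y yJ).
have idx x : exists2 i, (i < size S)%N &
    x \in nth finset.set0 (unzip1 S) i /\ g x = nth 0 (unzip2 S) i.
  have [p pS xp] := Sc x; exists (index p S); first by rewrite index_mem.
  have iS : (index p S < size S)%N by rewrite index_mem.
  rewrite !(nth_map (finset.set0, 0)) // nth_index //; split => //.
  by apply: (Sg p.1) => //; rewrite -surjective_pairing.
have nolt J x y i j : sign_run f J -> x \in J -> y \in J -> (i < j < size S)%N ->
    x \in nth finset.set0 (unzip1 S) i -> y \in nth finset.set0 (unzip1 S) j ->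
    g x = nth 0 (unzip2 S) i -> g y = nth 0 (unzip2 S) j -> False.
  move=> /andP[/andP[_ Jc] Jg] xJ yJ /andP[ij jS] xi yj gx gy.
  have iS : (i.+1 < size (unzip2 S))%N.
    by rewrite size_map; apply: leq_ltn_trans jS.
  have /eqP := alternation_neq _ _ S2 Sa iS; apply; rewrite -gx.
  have eqg z : z \in J -> g x = g z.
    by move=> zJ; apply/eqP; apply: (forall_inP (forall_inP Jg x xJ)).
  move: gy yj; have [<- gy _|ij1 gy yj] := eqVneq i.+1 j.
    by rewrite -gy; apply: eqg.
  rewrite size_map in iS.
  (* The point [w] of block [i.+1] lies strictly between [x] and [y], so the interval [J] contains
     it and [g w] must equal [g x]. *)
  have [w wi <-] := sign_blocks_nth _ _ _ SS iS.
  apply: eqg; apply: (implyP (forallP (forall_inP (forall_inP Jc x xJ) y yJ) w)).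
  apply/andP; split; apply: ltW.
    by apply: (blocks_nth_lt _ i i.+1 S0 Ss); rewrite // ltnSn size_map.
  apply: (blocks_nth_lt _ i.+1 j S0 Ss) => //.
  by rewrite ltn_neqAle ij1 ij size_map.
have sub I J x : I \in unzip1 S -> sign_run f J -> x \in I -> x \in J -> J \subset I.
  move=> IS Jr xI xJ; apply/fintype.subsetP => y yJ.
  have [j jS [yj gy]] := idx y.
  have iS : (index I (unzip1 S) < size S)%N by rewrite -(size_map fst) index_mem.
  have gx : g x = nth 0 (unzip2 S) (index I (unzip1 S)).
    apply: (Sg I) => //.
    rewrite -{1}(nth_index finset.set0 IS) !(nth_map (finset.set0, 0)) //.
    by rewrite -surjective_pairing mem_nth.
  rewrite -(nth_index finset.set0 IS) in xI *.
  case: (ltngtP (index I (unzip1 S)) j) => [ij|ji|->] //.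
    by case: (nolt J x y _ j Jr xJ yJ _ xI yj gx gy); rewrite ij.
  by case: (nolt J y x j _ Jr yJ xJ _ yj xI gy gx); rewrite ji.
split => // I; apply/idP/maxsetP => [IS|[Ir Im]].
  split; first exact: run.
  move=> J Jr IJ; have /set0Pn[x xI] := allP S0 _ IS.
  apply/eqP; rewrite finset.eqEsubset IJ andbT.
  by apply: (sub I J x) => //; apply: (fintype.subsetP IJ).
have /andP[/andP[/set0Pn[x xI] _] _] := Ir.
have [J JS xJ] := Sc1 x.
by rewrite -(Im J (run J JS) _) //; apply: (sub J I x).
Qed.

(** The blocks are the maximal sign runs in increasing order, so they depend only on the predicate
    [sign_run]. This lets opposite functions be compared. *)
Lemma cut_unzip1_eq (f1 f2 : R -> R) S1 S2 :
  (forall I, sign_run f1 I = sign_run f2 I) ->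
  cut_into_runs f1 S1 -> cut_into_runs f2 S2 -> unzip1 S1 = unzip1 S2.
Proof.
move=> eqf [s1 m1 _] [s2 m2 _]; apply: blocks_eq => //.
  by apply/allP => I; rewrite m1 => /maxsetP[/andP[/andP[]]].
by move=> I; rewrite m1 m2 (funext eqf).
Qed.

Lemma cut_unique (f : R -> R) S1 S2 :
  cut_into_runs f S1 -> cut_into_runs f S2 -> S1 = S2.
Proof.
move=> C1 C2; have e1 := cut_unzip1_eq f f S1 S2 (fun=> erefl) C1 C2.
have [_ m1 g1] := C1; have [_ m2 g2] := C2.
have sz : size S1 = size S2 by have := congr1 size e1; rewrite !size_map.
apply: (@eq_from_nth _ (finset.set0, 0)) => // i i1.
have i2 : (i < size S2)%N by rewrite -sz.
have eI : (nth (finset.set0, 0) S1 i).1 = (nth (finset.set0, 0) S2 i).1.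
  by have := congr1 (nth finset.set0 ^~ i) e1; rewrite !(nth_map (finset.set0, 0)).
move: (mem_nth (finset.set0, 0) i1) (mem_nth (finset.set0, 0) i2) eI.
case: (nth _ S1 i) => I s; case: (nth _ S2 i) => J t /= IS JS eI.
rewrite -{}eI in JS *; congr pair.
have : I \in unzip1 S1 by apply/mapP; exists (I, s).
rewrite m1 => /maxsetP[/andP[/andP[/set0Pn[x xI] _] _] _].
by rewrite -(g1 _ _ IS _ xI) (g2 _ _ JS _ xI).
Qed.

End Blocks.

(** * Alternating signs and roots of polynomials *)

Section AlternatingPolynomials.
Context {R : realType} {T : {fset R}}.
Implicit Types (p : {poly R}) (S : seq ({set T} * int)).

(** Each sign change gives a root strictly between two consecutive points. Recording that all roots
    exceed [x] makes the new root differ from the later ones. *)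
Lemma alternating_roots p (x : R) l :
  path (fun a b => (a < b) && (p.[a] * p.[b] < 0)) x l ->
  exists2 rs, size rs = size l & [/\ uniq rs, all (root p) rs & all (> x) rs].
Proof.
elim: l x => [|y l IH] x /=; first by exists [::].
move=> /andP[/andP[xy pxy] /IH[rs srs [urs rrs lrs]]].
have [c [xc cy rc]] : exists c, [/\ x < c, c < y & root p c].
  (* The intermediate value theorem is applied to a rise from negative to positive, so [q] is [p] or
     [- p]. *)
  have [q [qx qy qr]] : exists q : {poly R}, [/\ q.[x] < 0, 0 < q.[y] & root q =1 root p].
    have [px|px|px] := ltgtP p.[x] 0; last by rewrite px mul0r ltxx in pxy.
      by exists p; split => //; rewrite -(nmulr_rlt0 _ px).
    exists (- p); rewrite !hornerN oppr_lt0 oppr_gt0; split => //.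
      by rewrite -(pmulr_rlt0 _ px).
    by move=> z; rewrite rootN.
  have [|c /andP[xc cy] rc] := @poly_ivt R q x y (ltW xy); first by rewrite !ltW.
  exists c; rewrite -qr !lt_neqAle xc cy rc !andbT; split=> //.
    by apply: contraTneq rc => <-; rewrite rootE lt_eqF.
  by apply: contraTneq rc => ->; rewrite rootE gt_eqF.
exists (c :: rs) => /=; first by rewrite srs.
rewrite urs rc rrs xc andbT; split => //.
  by apply/negP => /(allP lrs) yc; have := lt_trans cy yc; rewrite ltxx.
by apply/allP => z /(allP lrs) yz; apply: lt_trans yz.
Qed.

(** Representatives of consecutive blocks carry opposite signs, so [m.+1] blocks give [m] distinct
    roots, and a nonzero [p] has fewer than [size p] roots. *)
Lemma sign_blocks_size p S : p != 0 -> (forall x : T, p.[val x] != 0) ->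
  sign_blocks S (fun x => sgz p.[val x]) -> (size S <= size p)%N.
Proof.
move=> p0 pn [S0 Ss Sa _ Sg].
(* One point is picked from each block; the default 0 never arises for [q] in [S], whose blocks are
   nonempty. *)
pose rep (q : {set T} * int) := odflt 0 (omap val [pick x in q.1]).
have repP q : q \in S -> exists2 x, x \in q.1 & rep q = val x.
  move=> qS; rewrite /rep; case: pickP => [x xq|q0]; first by exists x.
  by have /set0Pn[x] := allP S0 _ (map_f fst qS); rewrite q0.
have : sorted (fun a b => (a < b) && (p.[a] * p.[b] < 0)) (map rep S).
  rewrite sorted_map.
  apply: (@sub_in_sorted _ [in S]
    [rel a b | before a.1 b.1 && (a.2 == - b.2)]);
    [|by apply/allP|by rewrite sorted_relI; move: Ss Sa; rewrite !sorted_map => -> ->].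
  move=> a b aS bS /= /andP[/beforeP ab /eqP sab].
  have [x xa ->] := repP a aS; have [y yb ->] := repP b bS.
  rewrite ab //=; move: (Sg a.1 a.2) (Sg b.1 b.2).
  rewrite -!surjective_pairing => /(_ aS x xa) sx /(_ bS y yb) sy.
  rewrite -sgz_lt0 sgzM sx sab -sy mulNr oppr_lt0 -expr2 exprn_even_gt0 //=.
  by rewrite sgz_eq0 pn.
case: S {S0 Ss Sa Sg repP} => //= a S /alternating_roots[rs].
rewrite size_map => <- [urs rrs _].
exact: max_poly_roots rrs urs.
Qed.

(** The midpoint of the largest element of [I] and the smallest element of [J] separates them. *)
Lemma blocks_separated (I J : {set T}) : I != finset.set0 -> J != finset.set0 ->
  before I J -> exists c : R, {in I, forall x, val x < c} /\ {in J, forall x, c < val x}.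
Proof.
move=> /set0Pn[i0 i0I] /set0Pn[j0 j0J] /beforeP IJ.
have [i iI im] := @arg_maxP _ _ _ i0 [in I] val i0I.
have [j jJ jm] := @arg_minP _ _ _ j0 [in J] val j0J.
have [ic cj] := midf_lt (IJ i j iI jJ).
exists ((val i + val j) / 2); split => x xI.
  exact: le_lt_trans (im x xI) ic.
exact: lt_le_trans cj (jm x xI).
Qed.

Lemma sign_blocks_poly S : (0 < size S)%N ->
  all (fun I : {set T} => I != finset.set0) (unzip1 S) ->
  sorted (@before R T) (unzip1 S) ->
  all (fun s : int => (s == 1) || (s == -1)) (unzip2 S) ->
  alternation (unzip2 S) ->
  exists2 p : {poly R}, (size p <= size S)%N &
    forall I s, (I, s) \in S -> forall x, x \in I -> sgz p.[val x] = s.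
Proof.
case: S => // -[I s] S _.
(* Controlling the sign to the left of the first block makes the induction go
   through: multiplying by [X - c] flips it only there. *)
suff H : all (fun I : {set T} => I != finset.set0) (I :: unzip1 S) ->
    sorted (@before R T) (I :: unzip1 S) ->
    all (fun s : int => (s == 1) || (s == -1)) (s :: unzip2 S) ->
    alternation (s :: unzip2 S) ->
    exists p : {poly R}, [/\ (size p <= (size S).+1)%N,
      forall J t, (J, t) \in S -> forall x, x \in J -> sgz p.[val x] = t
      & forall y x, x \in I -> y <= val x -> sgz p.[y] = s].
  move=> S0 Ss S1 Sa; have [p [ps pS pI]] := H S0 Ss S1 Sa.
  exists p => // J t; rewrite inE => /orP[/eqP[-> ->] x xI|]; last exact: pS.
  exact: pI xI _.
elim: S I s => [|[J t] S IH] I s.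
  move=> _ _ /andP[s1 _] _; exists (s%:~R)%:P; split=> //.
    by rewrite size_polyC; case: eqP.
  move=> y x _ _; rewrite hornerC.
  by case/orP: s1 => /eqP->; rewrite ?intrN ?sgzN sgz1.
move=> /andP[I0 S0] /andP[IJ Ss] /andP[s1 S1] /andP[/eqP st Sa].
have [p [ps pS pJ]] := IH J t S0 Ss S1 Sa.
have /andP[J0 _] := S0.
have [c [Ic Jc]] := blocks_separated I J I0 J0 IJ.
exists (p * ('X - c%:P)); split.
- apply: leq_trans (size_polyMleq _ _) _.
  by rewrite size_XsubC addn2.
- move=> K u KS x xK; rewrite hornerM hornerXsubC sgzM.
  (* The new factor is positive on every block after [I], so the signs already arranged there are
     kept. *)
  have cx : c < val x.
    move: KS; rewrite inE => /orP[/eqP[eK _]|KS]; first by rewrite eK in xK; apply: Jc.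
    have /set0Pn[j jJ] := J0; apply: lt_trans (Jc j jJ) _.
    have : pairwise (@before R T) (J :: unzip1 S).
      by rewrite -(sorted_pairwise_in before_trans (s := J :: unzip1 S)).
    by move=> /andP[/allP/(_ K (map_f fst KS))/beforeP + _]; apply.
  rewrite [X in _ * X]gtr0_sgz ?subr_gt0 // mulr1.
  move: KS; rewrite inE => /orP[/eqP[eK ->]|KS]; last exact: pS KS _ xK.
  by rewrite eK in xK; apply: pJ xK _.
(* On [I] and to its left the new factor is negative and turns [t] into [s = - t]. *)
- move=> y x xI yx; rewrite hornerM hornerXsubC sgzM.
  rewrite [X in _ * X]ltr0_sgz ?subr_lt0 ?(le_lt_trans yx) ?Ic // mulrN1 st.
  have /set0Pn[j jJ] := J0; congr (- _); apply: (pJ y j jJ).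
  by apply: le_trans yx _; apply: ltW; apply: (beforeP _ _ IJ).
Qed.

End AlternatingPolynomials.

(** * Cells of constant sign vector, their closures and opposites *)

Section SignCells.
Context {R : realType} {d : nat} (T : {fset R}).
Implicit Types (xi eta : 'rV[R]_d.+1).

Lemma q_funE xi t : q_fun xi t = (rVpoly xi).[t].
Proof.
rewrite (horner_coef_wide _ (size_poly _ _)).
by apply: eq_bigr => i _; rewrite coef_rVpoly_ord.
Qed.

Lemma q_fun_lin a xi eta t : q_fun (a *: xi + eta) t = a * q_fun xi t + q_fun eta t.
Proof. by rewrite !q_funE linearP hornerD hornerZ. Qed.

Lemma q_funN xi t : q_fun (- xi) t = - q_fun xi t.
Proof. by rewrite !q_funE linearN hornerN. Qed.

Lemma q_fun_continuous t : continuous (fun xi => q_fun xi t).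
Proof.
move=> xi; apply: cvg_big => [||i _]; [exact: add_continuous|exact: nbhs_filter|].
apply: cvgM; [exact: nbhs_filter| |by apply: cvg_cst; exact: nbhs_filter].
exact: (@coord_continuous R 1 d.+1 0 i).
Qed.

(** Cells are indexed by a point instead of a sign vector, so each one is nonempty by
    construction. *)
Definition sign_cell xi : set 'rV[R]_d.+1 :=
  [set eta | forall t : T, sgz (q_fun eta (val t)) = sgz (q_fun xi (val t))].

Lemma sign_cell_eq xi eta : sign_cell xi eta -> sign_cell eta = sign_cell xi.
Proof.
by move=> xe; apply/seteqP; split=> z ze t; rewrite ze xe.
Qed.

Lemma arrangement_complP xi :
  arrangement_compl T xi <-> forall t : T, q_fun xi (val t) != 0.
Proof.
split=> [xU t|xU [t /= tT /eqP]].
  by apply/eqP => xt; apply: xU; exists (val t) => //; apply: valP.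
by apply/negP; apply: (xU [` tT]%fset).
Qed.

Lemma arrangement_compl_opp xi : arrangement_compl T xi -> arrangement_compl T (- xi).
Proof.
by move=> /arrangement_complP xU; apply/arrangement_complP => t; rewrite q_funN oppr_eq0.
Qed.

Lemma sign_cell_sub xi eta :
  arrangement_compl T xi -> sign_cell xi eta -> arrangement_compl T eta.
Proof.
move=> /arrangement_complP xU xe; apply/arrangement_complP => t.
by rewrite -sgz_eq0 xe sgz_eq0.
Qed.

Lemma near_sgz_q_fun xi t : q_fun xi t != 0 ->
  \forall eta \near xi, sgz (q_fun eta t) = sgz (q_fun xi t).
Proof.
have qc := @q_fun_continuous t xi.
have [x0|x0|//] := ltgtP (q_fun xi t) 0 => _.
  near=> eta; rewrite !ltr0_sgz //; near: eta.
  exact: (cvgr_lt _ qc).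
near=> eta; rewrite !gtr0_sgz //; near: eta.
exact: (cvgr_gt _ qc).
Unshelve. all: by end_near. Qed.

(** Each sign is locally constant off its hyperplane, and [T] is finite, so only finitely many
    neighbourhoods are intersected. *)
Lemma sign_cell_open xi : arrangement_compl T xi -> open (sign_cell xi).
Proof.
move=> xU; rewrite openE => eta xe.
have /arrangement_complP eU := sign_cell_sub _ _ xU xe.
rewrite /interior -(sign_cell_eq _ _ xe).
apply: (@filter_forall _ T (fun t z =>
  sgz (q_fun z (val t)) = sgz (q_fun eta (val t))) (nbhs eta)) => t.
by apply: near_sgz_q_fun.
Qed.

(** Evaluation at [t] maps the component onto an interval avoiding 0, so no sign changes on it.
    Conversely, the segment from [xi] to a point of the cell stays in the complement. *)
Lemma connected_component_cell xi : arrangement_compl T xi ->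
  connected_component (arrangement_compl T) xi = sign_cell xi.
Proof.
move=> xU; have /arrangement_complP xU' := xU.
apply/seteqP; split=> eta.
  move=> Ceta t; apply/eqP/negPn/negP => ne.
  have eU := connected_component_sub Ceta.
  have /arrangement_complP/(_ t) et := eU.
  have xt := xU' t.
  pose Q := [set q_fun z (val t) | z in connected_component (arrangement_compl T) xi].
  have /connected_intervalP Qi : connected Q.
    apply: connected_continuous_connected; first exact: component_connected.
    by apply: continuous_subspaceT; exact: q_fun_continuous.
  have Qx : Q (q_fun xi (val t)).
    by exists xi => //; apply: connected_component_refl.
  have Qe : Q (q_fun eta (val t)) by exists eta.
  have [z /connected_component_sub/arrangement_complP/(_ t) zt /eqP] : Q 0.
    move: ne; case: (ltgtP (q_fun xi (val t)) 0) xt => // x0 _;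
    case: (ltgtP (q_fun eta (val t)) 0) et => // e0 _.
    - by rewrite !ltr0_sgz // eqxx.
    - by move=> _; apply: (Qi _ _ Qx Qe); rewrite !ltW.
    - by move=> _; apply: (Qi _ _ Qe Qx); rewrite !ltW.
    - by rewrite !gtr0_sgz // eqxx.
  by apply/negP.
move=> xe.
pose f (s : R) := s *: (eta - xi) + xi.
have fc : continuous f.
  by move=> s; apply: cvgD; [exact: scalel_continuous|exact: cvg_cst].
apply: (@connected_component_max _ _ [set f s | s in `[0, 1]%classic] xi).
- by exists 0; rewrite /f ?scale0r ?add0r //= in_itv /= lexx ler01.
- move=> _ [s /= /[!in_itv]/= /andP[s0 s1] <-].
  apply: (sign_cell_sub xi) => // t; rewrite /f.
  have -> : s *: (eta - xi) + xi = s *: eta + (1 - s) *: xi.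
    by rewrite scalerBr scalerBl scale1r addrA addrAC -addrA [- _ + _]addrC addrA addrAC.
  rewrite q_fun_lin -[(1 - s) *: xi]addr0 q_fun_lin.
  have -> : q_fun (0 : 'rV[R]_d.+1) (val t) = 0 by rewrite q_funE linear0 horner0.
  rewrite addr0; have := xe t; have := xU' t.
  have s1' : 0 <= 1 - s by rewrite subr_ge0.
  case: (ltgtP (q_fun xi (val t)) 0) => // x0 _.
    rewrite (ltr0_sgz x0) => /eqP; rewrite sgz_cp0 => e0; apply: ltr0_sgz.
    (* At [s = 0] only the [xi] term remains; for [s > 0] the [eta] term is strictly signed, while
       the other may vanish at [s = 1]. *)
    move: s0; rewrite le_eqVlt => /orP[/eqP<-|s0].
      by rewrite mul0r add0r subr0 mul1r.
    by rewrite ltr_nwDl ?pmulr_rlt0 // mulr_ge0_le0 // ltW.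
  rewrite (gtr0_sgz x0) => /eqP; rewrite sgz_cp0 => e0; apply: gtr0_sgz.
  move: s0; rewrite le_eqVlt => /orP[/eqP<-|s0].
    by rewrite mul0r add0r subr0 mul1r.
  by rewrite ltr_wpDr ?mulr_gt0 // mulr_ge0 // ltW.
- apply: connected_continuous_connected; first exact: segment_connected.
  exact: continuous_subspaceT.
- by exists 1; rewrite /f ?scale1r ?subrK //= in_itv /= lexx ler01.
Qed.

(** Off the hyperplane of [t] the sign at [t] is constant near [eta], and every neighbourhood of
    [eta] meets the cell. *)
Lemma closure_sign_cell xi eta (t : T) : closure (sign_cell xi) eta ->
  q_fun eta (val t) != 0 -> sgz (q_fun eta (val t)) = sgz (q_fun xi (val t)).
Proof. by move=> ce /near_sgz_q_fun/ce[z [xz <-]]. Qed.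

(* The first basis vector is the constant polynomial 1: from a point with
   [q t = 0], moving along it against the sign of [q_xi t] leaves the closure. *)
Lemma interior_closure_cell xi : arrangement_compl T xi ->
  interior (closure (sign_cell xi)) = sign_cell xi.
Proof.
move=> xU; apply/seteqP; split; last first.
  by rewrite -open_subsetE; [exact: subset_closure|exact: sign_cell_open].
move=> eta ei; have ec := interior_subset ei.
move=> t; have [e0|] := eqVneq (q_fun eta (val t)) 0; last exact: closure_sign_cell.
have xt : q_fun xi (val t) != 0 by move/arrangement_complP: xU; apply.
pose f (s : R) := - (s * q_fun xi (val t)) *: 'e_0 + eta.
have f0 : f 0 = eta by rewrite /f mul0r oppr0 scale0r add0r.
have fc : {for 0, continuous f}.
  apply: cvgD; last exact: cvg_cst.
  apply: cvgZ; last exact: cvg_cst.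
  by apply: cvgN; apply: cvgM; [exact: cvg_id|exact: cvg_cst].
have fr := cvg_at_right_filter fc; rewrite f0 in fr.
have near_f : \forall s \near 0^'+, closure (sign_cell xi) (f s) by exact: (fr _ ei).
have [s [fs s0]] : exists s, closure (sign_cell xi) (f s) /\ 0 < s.
  by near (0 : R)^'+ => s; exists s; split; [near: s|].
have qf : q_fun (f s) (val t) = - (s * q_fun xi (val t)).
  rewrite /f q_fun_lin e0 addr0 [q_fun 'e_0 _]q_funE rVpoly_delta.
  by rewrite hornerXn expr0 mulr1.
have := closure_sign_cell _ _ t fs; rewrite qf oppr_eq0 mulf_neq0 // ?gt_eqF //.
rewrite sgzN sgzM gtr0_sgz // mul1r => /(_ isT).
by case: sgzP xt.
Unshelve. all: by end_near. Qed.

(** Identifying the interior with a sign cell lets any interior point represent its chamber. *)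
Lemma chamberP (sigma : set 'rV[R]_d.+1) : chambers T sigma -> exists xi,
  [/\ arrangement_compl T xi, sigma = closure (sign_cell xi) & interior sigma = sign_cell xi].
Proof.
move=> [xi xU ->]; exists xi.
by rewrite connected_component_cell // interior_closure_cell.
Qed.

Lemma sign_cell_chamber xi :
  arrangement_compl T xi -> chambers T (closure (sign_cell xi)).
Proof. by move=> xU; exists xi => //; rewrite connected_component_cell. Qed.

Lemma oppositeK : involutive (@opposite R d).
Proof.
move=> A; apply/seteqP; split=> x; first by move=> [_ [y Ay <-] <-]; rewrite opprK.
by move=> Ax; exists (- x); rewrite ?opprK //; exists x.
Qed.

Lemma opposite_sub (A B : set 'rV[R]_d.+1) : A `<=` B -> opposite A `<=` opposite B.
Proof. by move=> AB _ [x Ax <-]; exists x => //; apply: AB. Qed.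

(** Continuity of negation gives one inclusion; applied to [opposite A], it gives the other because
    negation is an involution. *)
Lemma opposite_closure (A : set 'rV[R]_d.+1) : opposite (closure A) = closure (opposite A).
Proof.
have sub (B : set 'rV[R]_d.+1) : opposite (closure B) `<=` closure (opposite B).
  move=> _ [x Bx <-] V Vx; have [y [By Vy]] := Bx _ (opp_continuous x _ Vx).
  by exists (- y); split => //; exists y.
apply/seteqP; split; first exact: sub.
rewrite -[X in X `<=` _]oppositeK; apply: opposite_sub.
by have := sub (opposite A); rewrite oppositeK.
Qed.

Lemma opposite_cell xi : opposite (closure (sign_cell xi)) = closure (sign_cell (- xi)).
Proof.
rewrite opposite_closure; congr closure; apply/seteqP; split=> [_ [x xx <-] t|x xx].
  by rewrite !q_funN !sgzN xx.
by exists (- x); rewrite ?opprK // => t; rewrite q_funN sgzN xx q_funN sgzN opprK.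
Qed.

Lemma opposite_chamber (sigma : set 'rV[R]_d.+1) : chambers T sigma -> chambers T (opposite sigma).
Proof.
move=> /chamberP[xi [xU -> _]]; rewrite opposite_cell.
by apply: sign_cell_chamber; apply: arrangement_compl_opp.
Qed.

End SignCells.

(** * Alternating sequences of signs *)

Lemma alternation_proportional (s s' : seq int) :
  all (fun a => (a == 1) || (a == -1)) s -> all (fun a => (a == 1) || (a == -1)) s' ->
  alternation s -> alternation s' -> size s = size s' ->
  exists2 e : int, (e == 1) || (e == -1) & s' = map ( *%R e) s.
Proof.
case: s s' => [|a s] [|b s'] //=; first by exists 1.
move=> /andP[a1 _] /andP[b1 _] sa sb [ss].
(* The factor is fixed by the first entries: [a * b] sends [a] to [b] since [a * a = 1]. Alternation
   propagates it to the rest. *)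
exists (a * b); first by case/orP: a1 => /eqP->; case/orP: b1 => /eqP->.
have : b = a * b * a by case/orP: a1 => /eqP->; rewrite ?mul1r ?mulr1 ?mulN1r ?mulrN1 ?opprK.
move: (a * b) => e be; rewrite -be; congr cons.
elim: s s' a b {a1 b1} sa sb ss be => [|c s IH] [|c' s'] //= a b.
move=> /andP[/eqP ac sc] /andP[/eqP bc sc'] [ss] be.
have ec : c' = e * c by apply: oppr_inj; rewrite -bc be ac mulrN.
by rewrite ec (IH s' c c').
Qed.

(** The orbit of 1 under negation; it equips an unsigned decomposition with signs. *)
Lemma alternating_signs (D : nat) : exists s : seq int,
  [/\ size s = D, all (fun a => (a == 1) || (a == -1)) s & alternation s].
Proof.
exists (traject -%R 1 D); rewrite size_traject; split => //.
  by apply/allP => s /trajectP[i _ ->]; elim: i => //= i /orP[]/eqP->; rewrite ?opprK eqxx ?orbT.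
case: D => //= D; have := fpath_traject (-%R : int -> int) 1 D.
by apply: sub_path => a b /eqP <-; rewrite opprK.
Qed.

(** * From chambers to signed decompositions and back *)

Section Chambers.
Context {R : realType} {d : nat} {T : {fset R}}.
Implicit Types (xi eta : 'rV[R]_d.+1) (S : seq ({set T} * int)).

(** The size of [rVpoly xi], at most [d.+1], bounds the number of blocks. A point of [T] shows that
    the polynomial is nonzero and that there is a block. *)
Lemma sign_blocks_decomposition xi S : (0 < #|` T|)%N -> arrangement_compl T xi ->
  sign_blocks S (fun x => sgz (q_fun xi (val x))) -> signed_decomposition d S.
Proof.
move=> T0 /arrangement_complP xU SS; have [S0 Ss Sa Sc Sg] := SS.
have [t0 t0T] : exists t, t \in T by apply/fset0Pn; rewrite -cardfs_gt0.
have size_le : (size S <= d.+1)%N.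
  apply: leq_trans (size_poly _ _).
  have qp (t : T) : (rVpoly xi).[val t] != 0 by rewrite -q_funE.
  apply: (sign_blocks_size _ _ _ qp).
    by apply: contra_neq (qp [` t0T]%fset) => ->; rewrite horner0.
  by split=> // I s IS x xI; rewrite -q_funE; apply: Sg xI.
apply/and3P; split => //.
  apply/decompositionP; split => //.
    rewrite size_map size_le andbT.
    by have [p] := Sc [` t0T]%fset; case: (S).
  by move=> x; have [p pS xp] := Sc x; exists p.1 => //; apply: map_f.
apply/allP => s /mapP[[I u] IS ->] /=.
have /set0Pn[x xI] := allP S0 _ (map_f fst IS).
rewrite -(Sg _ _ IS x xI); have := xU x.
by case: sgzP.
Qed.

(** The realising polynomial has size at most [d.+1], so its coefficients form a point of the
    space. *)
Lemma signed_decomposition_blocks S : signed_decomposition d S ->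
  exists xi, arrangement_compl T xi /\ sign_blocks S (fun x => sgz (q_fun xi (val x))).
Proof.
move=> /and3P[/decompositionP[/andP[Sgt Sle] S0 Ss Sc] S1 Sa].
rewrite !size_map in Sgt Sle.
have [p ps pS] := sign_blocks_poly S Sgt S0 Ss S1 Sa.
have qp t : q_fun (poly_rV p : 'rV[R]_d.+1) t = p.[t].
  by rewrite q_funE poly_rV_K // (leq_trans ps).
have cover x : exists2 q, q \in S & x \in q.1.
  by have [_ /mapP[q qS ->] xq] := Sc x; exists q.
exists (poly_rV p); split.
  apply/arrangement_complP => x; have [[I s] IS xI] := cover x.
  rewrite qp -sgz_eq0 (pS _ _ IS x xI).
  by have := allP S1 _ (map_f snd IS) => /= /orP[]/eqP->.
by split => // I s IS x xI; rewrite qp (pS _ _ IS).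
Qed.

Lemma cut_sgz (f : R -> R) S (I : {set T}) s (x : T) :
  cut_into_runs f S -> (I, s) \in S -> x \in I -> sgz (f (val x)) = s.
Proof. by move=> [_ _ +] IS xI; move=> /(_ _ _ IS x xI). Qed.

(** All interior points share one sign vector, so a single [S] serves them all: the assignment is
    well defined. *)
Lemma chamber_cut (sigma : set 'rV[R]_d.+1) : (0 < #|` T|)%N -> chambers T sigma ->
  exists S, signed_decomposition d S /\
    forall xi, interior sigma xi -> cut_into_runs (q_fun xi) S.
Proof.
move=> T0 /chamberP[xi [xU _ ->]].
have /arrangement_complP xU' := xU.
have [|S SS] := sign_blocks_exist (fun x : T => sgz (q_fun xi (val x))).
  by move=> x; have := xU' x; case: sgzP.
exists S; split; first exact: sign_blocks_decomposition SS.
move=> eta xe; apply: sign_blocks_cut.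
  exact/arrangement_complP/(sign_cell_sub T xi).
by rewrite (_ : (fun x : T => sgz (q_fun eta (val x))) =
  (fun x : T => sgz (q_fun xi (val x)))) //; apply/funext.
Qed.

Lemma chamber_of_interior (sigma : set 'rV[R]_d.+1) xi :
  chambers T sigma -> interior sigma xi -> sigma = closure (sign_cell T xi).
Proof. by move=> /chamberP[eta [_ sE ->]] /sign_cell_eq ->. Qed.

Lemma chamber_interior_nonempty (sigma : set 'rV[R]_d.+1) :
  chambers T sigma -> interior sigma !=set0.
Proof. by move=> /chamberP[eta [_ _ ->]]; exists eta. Qed.

Lemma opposite_interior (sigma : set 'rV[R]_d.+1) xi :
  chambers T sigma -> interior sigma xi -> interior (opposite sigma) (- xi).
Proof.
move=> cs /[dup] sx /(chamber_of_interior _ _ cs) ->; rewrite opposite_cell.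
have [eta [eU _ sE]] := chamberP _ _ cs; rewrite sE in sx.
have xU := sign_cell_sub _ _ _ eU sx.
by rewrite interior_closure_cell //; apply: arrangement_compl_opp.
Qed.

(** Alternating signs on the same blocks differ by a global factor [e]: [e = 1] gives the same cell
    and [e = -1] the opposite one. *)
Lemma cut_same_blocks (sigma tau : set 'rV[R]_d.+1) xi eta S1 S2 :
  chambers T sigma -> chambers T tau -> interior sigma xi -> interior tau eta ->
  signed_decomposition d S1 -> signed_decomposition d S2 ->
  cut_into_runs (q_fun xi) S1 -> cut_into_runs (q_fun eta) S2 ->
  unzip1 S1 = unzip1 S2 -> tau = sigma \/ tau = opposite sigma.
Proof.
move=> cs ct sx te /and3P[D1 s1 a1] /and3P[_ s2 a2] C1 C2 eq1.
have sz : size (unzip2 S1) = size (unzip2 S2).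
  by have := congr1 size eq1; rewrite !size_map.
have [e e1 eq2] := alternation_proportional _ _ s1 s2 a1 a2 sz.
have sgE (x : T) : sgz (q_fun eta (val x)) = e * sgz (q_fun xi (val x)).
  have [_ _ _ /(_ x)[_ /mapP[q qS ->] xq]] := decompositionP _ _ D1.
  have iS : (index q S1 < size S1)%N by rewrite index_mem.
  have iS2 : (index q S1 < size S2)%N by have := sz; rewrite !size_map => <-.
  have e1' : q.1 = (nth (finset.set0, 0) S2 (index q S1)).1.
    have := congr1 (nth finset.set0 ^~ (index q S1)) eq1.
    by rewrite !(nth_map (finset.set0, 0)) // nth_index.
  have e2' : (nth (finset.set0, 0) S2 (index q S1)).2 = e * q.2.
    have := congr1 (nth 0 ^~ (index q S1)) eq2.
    by rewrite -map_comp !(nth_map (finset.set0, 0)) //= nth_index.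
  rewrite (cut_sgz _ _ q.1 q.2 x C1) // -?surjective_pairing // -e2'.
  apply: (cut_sgz _ _ q.1 _ x C2) => //.
  by rewrite {1}e1' -surjective_pairing mem_nth.
rewrite (chamber_of_interior _ _ cs sx) (chamber_of_interior _ _ ct te) opposite_cell.
case/orP: e1 sgE => /eqP-> sgE; [left|right]; congr closure; apply: sign_cell_eq => t.
  by rewrite sgE mul1r.
by rewrite sgE mulN1r q_funN sgzN.
Qed.

End Chambers.

(** * The bijections for chambers and for opposite pairs *)

Theorem theorem2p14 (R : realType) (d n : nat) (T : {fset R})
    (hd : (1 <= d)%N) (hn : (d.+1 <= n)%N) (hT : #|` T| = n) :
  exists Phi : set 'rV[R]_d.+1 -> seq ({set T} * int),
    [/\ forall sigma, chambers T sigma ->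
          interior sigma !=set0 /\
          forall xi, interior sigma xi -> cut_into_runs (q_fun xi) (Phi sigma),
        set_bij (@chambers R d T) [set S | signed_decomposition d S] Phi
      & exists Psi : set (set 'rV[R]_d.+1) -> seq {set T},
          (forall sigma, chambers T sigma ->
             chambers T (opposite sigma) /\
             Psi [set sigma; opposite sigma] = unzip1 (Phi sigma)) /\
          set_bij (@opposite_pairs R d T) [set D | decomposition d D] Psi].
Proof.
have T0 : (0 < #|` T|)%N by rewrite hT (leq_trans _ hn).
(* Choice needs a value at every set; sets that are not chambers get the dummy value [[::]]. *)
have /choice[Phi PhiP] (sigma : set 'rV[R]_d.+1) : exists S : seq ({set T} * int),
    chambers T sigma -> signed_decomposition d S /\
      forall xi, interior sigma xi -> cut_into_runs (q_fun xi) S.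
  have [cs|ncs] := pselect (chambers T sigma).
    by have [S SP] := chamber_cut _ T0 cs; exists S.
  by exists [::].
have Phi_eq sigma tau : chambers T sigma -> chambers T tau ->
    unzip1 (Phi sigma) = unzip1 (Phi tau) -> tau = sigma \/ tau = opposite sigma.
  move=> cs ct; have [Ss Cs] := PhiP _ cs; have [St Ct] := PhiP _ ct.
  have [xi sx] := chamber_interior_nonempty _ cs.
  have [eta te] := chamber_interior_nonempty _ ct.
  exact: cut_same_blocks cs ct sx te Ss St (Cs _ sx) (Ct _ te).
have Phi_opp sigma : chambers T sigma -> unzip1 (Phi (opposite sigma)) = unzip1 (Phi sigma).
  move=> cs; have [_ Cs] := PhiP _ cs; have [_ Co] := PhiP _ (opposite_chamber _ _ cs).
  have [xi sx] := chamber_interior_nonempty _ cs.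
  apply: cut_unzip1_eq (Co _ (opposite_interior _ _ cs sx)) (Cs _ sx) => I.
  rewrite /sign_run; congr andb; apply: eq_forallb => x; congr implb.
  by apply: eq_forallb => y; rewrite !q_funN !sgzN eqr_opp.
have Phi_surj S : signed_decomposition d S -> exists2 sigma, chambers T sigma & Phi sigma = S.
  move=> /signed_decomposition_blocks[xi [xU SS]].
  have cs := sign_cell_chamber _ _ xU; exists (closure (sign_cell T xi)) => //.
  have [_ Cs] := PhiP _ cs; apply: (cut_unique (q_fun xi)).
    by apply: Cs; rewrite interior_closure_cell.
  by apply: sign_blocks_cut SS; apply/arrangement_complP.
exists Phi; split.
- move=> sigma cs; split; first exact: chamber_interior_nonempty cs.
  by have [] := PhiP _ cs.
- split.
  + by move=> sigma cs; have [] := PhiP _ cs.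
  + move=> sigma tau /[!inE] cs ct eqP.
    have [xi sx] := chamber_interior_nonempty _ cs.
    have [eta te] := chamber_interior_nonempty _ ct.
    have [Ss Cs] := PhiP _ cs; have [_ Ct] := PhiP _ ct.
    rewrite (chamber_of_interior _ _ cs sx) (chamber_of_interior _ _ ct te).
    congr closure; apply/esym/sign_cell_eq => t.
    (* The signs of [xi] and [eta] at [t] are read off the same pair of the common list. *)
    have /and3P[/decompositionP[_ _ _ /(_ t)[_ /mapP[[I s] IS ->] tI]] _ _] := Ss.
    rewrite (cut_sgz _ _ _ _ _ (Cs _ sx) IS tI).
    by rewrite eqP in IS; rewrite (cut_sgz _ _ _ _ _ (Ct _ te) IS tI).
  + by move=> S /Phi_surj[sigma cs <-]; exists sigma.
(* The value must not depend on which chamber of the pair is named; [Phi_opp] provides this. *)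
have /choice[Psi PsiP] (A : set (set 'rV[R]_d.+1)) : exists D : seq {set T},
    forall sigma, chambers T sigma -> A = [set sigma; opposite sigma] ->
      D = unzip1 (Phi sigma).
  have [[sigma [cs eA]]|nA] :=
      pselect (exists sigma, chambers T sigma /\ A = [set sigma; opposite sigma]).
    exists (unzip1 (Phi sigma)) => tau ct; rewrite eA => est.
    have : [set sigma; opposite sigma] tau by rewrite est; left.
    by case=> ->; rewrite ?Phi_opp.
  by exists [::] => sigma cs eA; case: nA; exists sigma.
exists Psi; split.
  by move=> sigma cs; split; [exact: opposite_chamber|exact: PsiP cs _].
split.
- move=> _ [sigma cs <-]; rewrite (PsiP _ _ cs erefl) /=.
  by have [/and3P[]] := PhiP _ cs.
- move=> A B /[!inE] -[sigma cs eA] [tau ct eB].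
  rewrite (PsiP _ _ cs (esym eA)) (PsiP _ _ ct (esym eB)) -eA -eB.
  (* Chambers with equal blocks are equal or opposite, and either way they span the same unordered
     pair. *)
  by move=> /(Phi_eq _ _ cs ct)[->|->] //; rewrite oppositeK setUC.
- move=> D /= DD.
  (* Any alternating signs turn [D] into a signed decomposition, to which surjectivity of [Phi]
     applies. *)
  have [s [ss s1 sa]] := alternating_signs (size D).
  have Ds : unzip1 (zip D s) = D by rewrite unzip1_zip ?ss.
  have [|sigma cs eS] := Phi_surj (zip D s).
    by apply/and3P; rewrite Ds unzip2_zip ?ss.
  exists [set sigma; opposite sigma]; first by exists sigma.
  by rewrite (PsiP _ _ cs erefl) eS.
Qed.
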